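(* Let $\mathbb{F}$ be a field of positive characteristic $p$, let $X$ be a nonempty finite set and let $S=\{R_0,\dots,R_d\}$ be a quasi-thin association scheme on $X$. Then $S$ is $p$-transitive if and only if either $p>2$, or $p=2$ and $S=O^\vartheta(S)O_\vartheta(S)$ (the complex product of the thin residue and the thin radical).
   Context: An association scheme on $X$ is a partition $S=\{R_0,\dots,R_d\}$ of $X\times X$ into nonempty relations such that $R_0=\{(x,x):x\in X\}$; for each $i$ the relation $\{(y,x):(x,y)\in R_i\}$ equals some $R_{i^*}\in S$; and for all $i,j,k$ the number $p_{ij}^k=|\{z\in X:(x,z)\in R_i,(z,y)\in R_j\}|$ does not depend on the choice of $(x,y)\in R_k$. The valency of $R_i$ is $k_i=p_{ii^*}^0$. $S$ is quasi-thin if $k_i\le 2$ for all $i$. For nonempty $U,V\subseteq S$, the complex product is $UV=\{R_k\in S:\exists R_u\in U,\exists R_v\in V,\ p_{uv}^k>0\}$. A nonempty $T\subseteq S$ is a closed subset if $T^*T\subseteq T$, where $T^*=\{R_{i^*}:R_i\in T\}$; it is strongly normal if moreover $R_{i^*}TR_i\subseteq T$ for all $i$ (writing $R_i$ for $\{R_i\}$). The thin radical is $O_\vartheta(S)=\{R_i\in S:k_i=1\}$; the thin residue $O^\vartheta(S)$ is the intersection of all strongly normal closed subsets of $S$. Let $A_i\in M_X(\mathbb{Z})$ be the $(0,1)$ adjacency matrix of $R_i$, $\overline{A_i}$ its image in $M_X(\mathbb{F})$, and $\mathbb{F}S$ the $\mathbb{F}$-span of $\overline{A_0},\dots,\overline{A_d}$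 (the modular adjacency algebra, a subalgebra of $M_X(\mathbb{F})$ with basis $\overline{A_0},\dots,\overline{A_d}$). The trivial $\mathbb{F}S$-module is a one-dimensional space on which $\overline{A_i}$ acts as the scalar $\overline{k_i}$ (image of $k_i$ in $\mathbb{F}$). A trivial submodule of the regular module $\mathbb{F}S$ (acting by left multiplication) is a subspace $\langle v\rangle_{\mathbb{F}}$ with $0\ne v\in\mathbb{F}S$ and $\overline{A_i}v=\overline{k_i}v$ for all $i$. $S$ is called $p$-transitive if the regular $\mathbb{F}S$-module has a unique trivial submodule. *)

(* Defs.v *)
From mathcomp Require Import all_boot all_order all_algebra.

Set Implicit Arguments.
Unset Strict Implicit.
Unset Printing Implicit Defensive.

Import GRing.Theory.

Definition diag_rel (X : finType) : {set X * X} := [set u | u.1 == u.2].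

Definition conv_rel (X : finType) (r : {set X * X}) : {set X * X} :=
  [set u | (u.2, u.1) \in r].

Definition inter_count (X : finType) (r s : {set X * X}) (u : X * X) : nat :=
  #|[set z : X | ((u.1, z) \in r) && ((z, u.2) \in s)]|.

(* A scheme is the set S of its relations; no enumeration R_0, ..., R_d is
   chosen, R_0 being diag_rel X and R_{i^*} being conv_rel R_i. *)
Record association_scheme (X : finType) (S : {set {set X * X}}) : Prop := {
  scheme_partition : partition S [set: X * X];
  scheme_diag : diag_rel X \in S;
  scheme_conv : forall r, r \in S -> conv_rel r \in S;
  scheme_regular : forall r s t, r \in S -> s \in S -> t \in S ->
    forall u v, u \in t -> v \in t -> inter_count r s u = inter_count r s v }.

(* p_{rs}^t, computed at some pair of t; the value 0 for t empty is never used,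
   as the relations of a scheme are nonempty. *)
Definition inter_num (X : finType) (r s t : {set X * X}) : nat :=
  if [pick u in t] is Some u then inter_count r s u else 0.

Definition valency (X : finType) (r : {set X * X}) : nat :=
  inter_num r (conv_rel r) (diag_rel X).

Definition quasi_thin (X : finType) (S : {set {set X * X}}) : Prop :=
  forall r, r \in S -> valency r <= 2.

Definition complex_prod (X : finType) (S U V : {set {set X * X}}) :
    {set {set X * X}} :=
  [set t in S | [exists u in U, exists v in V, 0 < inter_num u v t]].

Definition closed_subset (X : finType) (S T : {set {set X * X}}) : bool :=
  [&& T != set0, T \subset S
    & complex_prod S [set conv_rel r | r in T] T \subset T].

Definition strongly_normal (X : finType) (S T : {set {set X * X}}) : bool :=
  closed_subset S T &&
  [forall r in S,
     complex_prod S (complex_prod S [set conv_rel r] T) [set r] \subset T].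

Definition thin_radical (X : finType) (S : {set {set X * X}}) :
    {set {set X * X}} :=
  [set r in S | valency r == 1].

Definition thin_residue (X : finType) (S : {set {set X * X}}) :
    {set {set X * X}} :=
  \bigcap_(T : {set {set X * X}} | strongly_normal S T) T.

Local Open Scope ring_scope.

(* Rows and columns are indexed by X through its canonical enumeration. *)
Definition adj_int (X : finType) (r : {set X * X}) : 'M[int]_#|X| :=
  \matrix_(i, j) ((enum_val i, enum_val j) \in r)%:R.

Definition adj (F : fieldType) (X : finType) (r : {set X * X}) :
    'M[F]_#|X| :=
  map_mx (fun z : int => z%:~R) (adj_int r).

Definition adjacency_algebra (F : fieldType) (X : finType)
    (S : {set {set X * X}}) : {vspace 'M[F]_#|X|} :=
  <<[seq adj F r | r <- enum S]>>%VS.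

Definition trivial_submodule (F : fieldType) (X : finType)
    (S : {set {set X * X}}) (V : {vspace 'M[F]_#|X|}) : Prop :=
  exists v : 'M[F]_#|X|,
    [/\ v \in adjacency_algebra F S, v != 0,
        forall r, r \in S -> adj F r *m v = (valency r)%:R *: v
      & V = <[v]>%VS].

Definition p_transitive (F : fieldType) (X : finType)
    (S : {set {set X * X}}) : Prop :=
  exists! V : {vspace 'M[F]_#|X|}, trivial_submodule S V.

(* Main.v *)
Require Import Defs.
From mathcomp Require Import all_boot all_order all_algebra.

(** Identify an element of FS with a function [c] on X * X that is constant on
    the relations of S.  It spans a trivial submodule iff, for each relation r,
    the sum of [c z y] over the r-neighbours z of x is [k_r * c x y]; the
    constants are solutions, so p-transitivity says that there are no others.
    For odd p, the valencies 1 and 2 are invertible, and taking x = y forces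
    [c] to be constant.  For p = 2 the condition says that [c _ y] is invariant
    under thin relations and takes the same value at any two r-neighbours of a
    common point.  The latter pairs generate the thin residue, so the solutions
    are the functions invariant under O^theta(S) O_theta(S) on the left, and
    the indicator of this complex product is one of them. *)

Set Implicit Arguments.
Unset Strict Implicit.
Unset Printing Implicit Defensive.

Import GRing.Theory.

(** * Relations of a scheme as relations of pairs of points *)

(** Elements of S are handled through pairs of points, so that conditions on intersection numbers
    become statements about paths in X. *)
Definition rel_of (X : finType) (S : {set {set X * X}}) (x y : X) :
    {set X * X} := pblock S (x, y).

Lemma rel_of_in (X : finType) (S : {set {set X * X}}) x y :
  association_scheme S -> rel_of S x y \in S.
Proof. by case=> /and3P[/eqP cS _ _] _ _ _; rewrite pblock_mem ?cS. Qed.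

Lemma mem_rel_of (X : finType) (S : {set {set X * X}}) x y :
  association_scheme S -> (x, y) \in rel_of S x y.
Proof. by case=> /and3P[/eqP cS _ _] _ _ _; rewrite mem_pblock cS. Qed.

Lemma mem_relE (X : finType) (S : {set {set X * X}}) r x y :
  association_scheme S -> r \in S -> ((x, y) \in r) = (rel_of S x y == r).
Proof.
move=> hS rS; have [/and3P[_ tS _] _ _ _] := hS.
apply/idP/eqP => [xyr|<-]; last exact: mem_rel_of.
exact: def_pblock tS rS xyr.
Qed.

Lemma rel_of_ex (X : finType) (S : {set {set X * X}}) r :
  association_scheme S -> r \in S -> exists x y, r = rel_of S x y.
Proof.
move=> hS rS; have [/and3P[_ _ S0] _ _ _] := hS.
have /set0Pn[[x y]] : r != set0 by apply: contraNneq S0 => <-.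
by rewrite (mem_relE _ _ hS rS) => /eqP <-; exists x, y.
Qed.

Lemma rel_of_conv (X : finType) (S : {set {set X * X}}) x y :
  association_scheme S -> conv_rel (rel_of S x y) = rel_of S y x.
Proof.
move=> hS; apply/esym/eqP; rewrite -mem_relE //.
  by rewrite inE; exact: mem_rel_of.
by apply: scheme_conv => //; exact: rel_of_in.
Qed.

Lemma rel_of_swap (X : finType) (S : {set {set X * X}}) x y x' y' :
  association_scheme S -> rel_of S x y = rel_of S x' y' ->
  rel_of S y x = rel_of S y' x'.
Proof. by move=> hS e; rewrite -(rel_of_conv x y hS) -(rel_of_conv x' y' hS) e. Qed.

Lemma rel_of_diag (X : finType) (S : {set {set X * X}}) x :
  association_scheme S -> rel_of S x x = diag_rel X.
Proof.
move=> hS; apply/eqP; rewrite -mem_relE ?inE //; exact: scheme_diag.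
Qed.

Lemma inter_numE (X : finType) (S : {set {set X * X}}) r s x y :
  association_scheme S -> r \in S -> s \in S ->
  inter_num r s (rel_of S x y) = inter_count r s (x, y).
Proof.
move=> hS rS sS; rewrite /inter_num; case: pickP => [u ut|/(_ (x, y))].
  by apply: (scheme_regular hS rS sS (rel_of_in x y hS)) => //; exact: mem_rel_of.
by rewrite mem_rel_of.
Qed.

Lemma inter_num_gt0P (X : finType) (S : {set {set X * X}}) r s x y :
  association_scheme S -> r \in S -> s \in S ->
  reflect (exists z, rel_of S x z = r /\ rel_of S z y = s)
          (0 < inter_num r s (rel_of S x y)).
Proof.
move=> hS rS sS; rewrite inter_numE // card_gt0.
apply: (iffP (set0Pn _)) => -[z].
  by rewrite inE !(mem_relE _ _ hS) // => /andP[/eqP xz /eqP zy]; exists z.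
by case=> xz zy; exists z; rewrite inE !(mem_relE _ _ hS) //= xz zy !eqxx.
Qed.

(** Regularity as a lifting property: the intersection number counting points such as [w] is
    positive at (x, y), hence also at (x', y'). *)
Lemma rel_of_extend (X : finType) (S : {set {set X * X}}) x y x' y' w :
  association_scheme S -> rel_of S x y = rel_of S x' y' ->
  exists w', rel_of S x' w' = rel_of S x w /\ rel_of S y' w' = rel_of S y w.
Proof.
move=> hS e.
have: 0 < inter_num (rel_of S x w) (rel_of S w y) (rel_of S x y).
  by apply/inter_num_gt0P; rewrite ?rel_of_in //; exists w.
rewrite e => /inter_num_gt0P[]; rewrite ?rel_of_in // => w' [e1 e2].
by exists w'; split=> //; exact: rel_of_swap.
Qed.

Lemma rel_of_copy (X : finType) (S : {set {set X * X}}) x y x' :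
  association_scheme S -> exists y', rel_of S x' y' = rel_of S x y.
Proof.
move=> hS; have e : rel_of S x x = rel_of S x' x' by rewrite !rel_of_diag.
by have [y' [e1 _]] := rel_of_extend y hS e; exists y'.
Qed.

(** * Valencies *)

Lemma valencyE (X : finType) (S : {set {set X * X}}) r x :
  association_scheme S -> r \in S ->
  valency r = #|[set z | (x, z) \in r]|.
Proof.
move=> hS rS; rewrite /valency -(rel_of_diag x hS) inter_numE //; last first.
  exact: scheme_conv.
by apply: eq_card => z; rewrite !inE /= andbb.
Qed.

Lemma valency_gt0 (X : finType) (S : {set {set X * X}}) r :
  association_scheme S -> r \in S -> 0 < valency r.
Proof.
move=> hS rS; have [x [y e]] := rel_of_ex hS rS.
rewrite (valencyE x hS rS) card_gt0; apply/set0Pn; exists y.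
by rewrite inE e mem_rel_of.
Qed.

Lemma card_relE (X : finType) (S : {set {set X * X}}) r :
  association_scheme S -> r \in S -> #|r| = #|X| * valency r.
Proof.
move=> hS rS; rewrite -sum1_card -sum_nat_const.
transitivity (\sum_(x in X) \sum_(y | (x, y) \in r) 1).
  by rewrite pair_big_dep; apply: eq_bigl => -[x y].
apply: eq_bigr => x _; rewrite (valencyE x hS rS) -sum1_card.
by apply: eq_bigl => y; rewrite inE.
Qed.

(** A relation and its converse have equally many pairs, namely [#|X|] times the respective
    valency. *)
Lemma valency_conv (X : finType) (S : {set {set X * X}}) r :
  association_scheme S -> r \in S -> valency (conv_rel r) = valency r.
Proof.
move=> hS rS; have [x [_ _]] := rel_of_ex hS rS.
have X0 : 0 < #|X| by apply/card_gt0P; exists x.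
apply/eqP; rewrite -(eqn_pmul2l X0) -!(card_relE hS) //; last exact: scheme_conv.
have -> : conv_rel r = [set (u.2, u.1) | u in r].
  apply/setP=> -[a b]; rewrite inE /=; apply/idP/imsetP => [h|[[c d] h [-> ->]]] //.
  by exists (b, a).
by rewrite card_imset // => -[a b] [c d] [-> ->].
Qed.

(** * Complex products, closed and strongly normal subsets *)

Lemma complex_prodP (X : finType) (S U V : {set {set X * X}}) x y :
  association_scheme S -> U \subset S -> V \subset S ->
  reflect (exists z, rel_of S x z \in U /\ rel_of S z y \in V)
          (rel_of S x y \in complex_prod S U V).
Proof.
move=> hS /subsetP US /subsetP VS; rewrite inE rel_of_in //=.
apply: (iffP exists_inP) => [[u uU /exists_inP[v vV]]|[z [xz zy]]].
  by case/inter_num_gt0P; auto => z [xz zy]; exists z; rewrite xz zy.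
exists (rel_of S x z) => //; apply/exists_inP; exists (rel_of S z y) => //.
by apply/inter_num_gt0P; auto; exists z.
Qed.

Lemma complex_prod_sub (X : finType) (S U V : {set {set X * X}}) :
  complex_prod S U V \subset S.
Proof. by apply/subsetP=> t; rewrite inE => /andP[]. Qed.

Lemma conv_set_sub (X : finType) (S T : {set {set X * X}}) :
  association_scheme S -> T \subset S ->
  [set conv_rel r | r in T] \subset S.
Proof.
move=> hS /subsetP TS; apply/subsetP=> _ /imsetP[r /TS rS ->].
exact: scheme_conv.
Qed.

Lemma mem_conv_set (X : finType) (S T : {set {set X * X}}) x y :
  association_scheme S -> T \subset S ->
  (rel_of S x y \in [set conv_rel r | r in T]) = (rel_of S y x \in T).
Proof.
move=> hS /subsetP TS; apply/imsetP/idP => [[r rT e]|yxT].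
  have [a [b er]] := rel_of_ex hS (TS _ rT).
  rewrite er rel_of_conv // in e.
  by rewrite (rel_of_swap hS e) -er.
by exists (rel_of S y x); rewrite ?rel_of_conv.
Qed.

(** The inclusion of T^*T in T, read along the path y, x, z. For nonempty T it says that being
    related by T is an equivalence relation on X. *)
Lemma closed_subsetP (X : finType) (S T : {set {set X * X}}) :
  association_scheme S -> T \subset S -> T != set0 ->
  reflect (forall x y z, rel_of S x y \in T -> rel_of S x z \in T ->
             rel_of S y z \in T)
          (closed_subset S T).
Proof.
move=> hS TS T0; rewrite /closed_subset T0 TS /=; have cTS := conv_set_sub hS TS.
apply: (iffP subsetP) => [cl x y z xy xz|cl t tP].
  by apply: cl; apply/complex_prodP => //; exists x; rewrite mem_conv_set.
have [y [z et]] := rel_of_ex hS (subsetP (complex_prod_sub _ _ _) _ tP).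
move: tP; rewrite et => /complex_prodP[] // x.
by rewrite mem_conv_set // => -[xy xz]; exact: cl xy xz.
Qed.

(** The inclusion of r^* T r in T, read along the path y, x, x', y' whose outer steps belong to r^*
    and r. *)
Lemma strongly_normalP (X : finType) (S T : {set {set X * X}}) :
  association_scheme S -> closed_subset S T ->
  reflect (forall x y x' y', rel_of S x y = rel_of S x' y' ->
             rel_of S x x' \in T -> rel_of S y y' \in T)
          (strongly_normal S T).
Proof.
move=> hS clT; rewrite /strongly_normal clT /=.
have /and3P[_ TS _] := clT.
have sub1 r : r \in S -> [set r] \subset S by rewrite sub1set.
have conj x y y' : reflect
    (exists x1 x', [/\ rel_of S x1 y = rel_of S x y, rel_of S x1 x' \in T
                     & rel_of S x' y' = rel_of S x y])
    (rel_of S y y' \in complex_prod S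
        (complex_prod S [set conv_rel (rel_of S x y)] T) [set rel_of S x y]).
  have cS : [set conv_rel (rel_of S x y)] \subset S.
    by apply: sub1; apply: scheme_conv => //; exact: rel_of_in.
  have rS : [set rel_of S x y] \subset S by apply: sub1; exact: rel_of_in.
  apply: (iffP (complex_prodP _ _ hS (complex_prod_sub _ _ _) rS)).
    case=> x' [/complex_prodP[] // x1 []]; rewrite !inE rel_of_conv //.
    by move=> /eqP e1 x1x' /eqP e2; exists x1, x'; split=> //; exact: rel_of_swap.
  case=> x1 [x' [e1 t e2]]; exists x'; split; last by rewrite inE e2.
  apply/complex_prodP => //; exists x1; split=> //.
  by rewrite inE rel_of_conv // (rel_of_swap hS e1).
apply: (iffP forall_inP) => [sn x y x' y' e xx'|sn r rS].
  apply: (subsetP (sn _ (rel_of_in x y hS))); apply/conj.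
  by exists x, x'.
have [x [y0 er]] := rel_of_ex hS rS.
apply/subsetP=> t tP.
have [y [y' et]] := rel_of_ex hS (subsetP (complex_prod_sub _ _ _) _ tP).
(* [conj] needs r written as the relation of a pair ending in [y]. *)
have [x1 ex1] : exists x1, rel_of S x1 y = rel_of S x y0.
  have [x1 e1] := rel_of_copy y0 x y hS.
  by exists x1; exact: rel_of_swap.
move: tP; rewrite et er -ex1 => /conj[a [x' [e1 t1 e2]]].
by apply: (sn a y x' y') => //; rewrite e1 e2.
Qed.

(** If (a, b) lies in a relation of T, the path b, a, b puts the diagonal in T. *)
Lemma closed_diag (X : finType) (S T : {set {set X * X}}) x :
  association_scheme S -> closed_subset S T -> rel_of S x x \in T.
Proof.
move=> hS clT; have /and3P[T0 TS _] := clT.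
have /set0Pn[t tT] := T0.
have [a [b et]] := rel_of_ex hS (subsetP TS _ tT).
rewrite rel_of_diag // -(rel_of_diag b hS).
by apply: (closed_subsetP hS TS T0 clT a); rewrite -et.
Qed.

(** * The thin residue *)

(** Makes the family intersected in [thin_residue] nonempty, so that the thin residue lies in S. *)
Lemma scheme_strongly_normal (X : finType) (S : {set {set X * X}}) :
  association_scheme S -> strongly_normal S S.
Proof.
move=> hS; apply/strongly_normalP => //; last by move=> *; exact: rel_of_in.
apply/closed_subsetP => //; last by move=> *; exact: rel_of_in.
by apply/set0Pn; exists (diag_rel X); exact: scheme_diag.
Qed.

Lemma thin_residue_sub (X : finType) (S : {set {set X * X}}) :
  association_scheme S -> thin_residue S \subset S.
Proof. by move=> hS; apply: bigcap_inf; exact: scheme_strongly_normal. Qed.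

Lemma thin_residue_closed (X : finType) (S : {set {set X * X}}) :
  association_scheme S -> closed_subset S (thin_residue S).
Proof.
move=> hS; apply/closed_subsetP => //; first exact: thin_residue_sub.
  apply/set0Pn; exists (diag_rel X); apply/bigcapP => T /andP[clT _].
  have /and3P[T0 TS _] := clT; have /set0Pn[t /(subsetP TS) tS] := T0.
  by have [x _] := rel_of_ex hS tS; rewrite -(rel_of_diag x hS) closed_diag.
move=> x y z /bigcapP xy /bigcapP xz; apply/bigcapP => T snT.
have /andP[clT _] := snT; have /and3P[T0 TS _] := clT.
exact: (closed_subsetP hS TS T0 clT) (xy _ snT) (xz _ snT).
Qed.

Lemma thin_residue_normal (X : finType) (S : {set {set X * X}}) :
  association_scheme S -> strongly_normal S (thin_residue S).
Proof.
move=> hS; apply/strongly_normalP; rewrite ?thin_residue_closed //.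
move=> x y x' y' e /bigcapP xx'; apply/bigcapP => T snT.
have /andP[clT _] := snT.
exact: (strongly_normalP hS clT snT) e (xx' _ snT).
Qed.

(** Strong normality applied to two steps of the same relation from [x], since the pair (x, x)
    belongs to the residue. *)
Lemma thin_residue_fork (X : finType) (S : {set {set X * X}}) x y y' :
  association_scheme S -> rel_of S x y = rel_of S x y' ->
  rel_of S y y' \in thin_residue S.
Proof.
move=> hS e; have clR := thin_residue_closed hS.
apply: (strongly_normalP hS clR (thin_residue_normal hS)) e _.
exact: closed_diag.
Qed.

(* The closed subset of relations contained in E need not be strongly normal;
   the set of t with [r^* t r] contained in E for all r is. *)
Lemma thin_residue_min (X : finType) (S : {set {set X * X}}) (E : rel X) :
  association_scheme S ->
  (forall x y, E x y -> E y x) ->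
  (forall x y z, E x y -> E y z -> E x z) ->
  (forall x y y', rel_of S x y = rel_of S x y' -> E y y') ->
  forall x y, rel_of S x y \in thin_residue S -> E x y.
Proof.
move=> hS Esym Etr Efork x y.
pose T := [set t in S | [forall u : X * X, forall v : X * X,
  (rel_of S u.1 v.1 == t) ==> (rel_of S u.1 u.2 == rel_of S v.1 v.2)
    ==> E u.2 v.2]].
have TS : T \subset S by apply/subsetP=> t; rewrite inE => /andP[].
have TP t : t \in S -> reflect
    (forall a a' b b', rel_of S a a' = t -> rel_of S a b = rel_of S a' b' ->
       E b b') (t \in T).
  move=> tS; rewrite inE tS /=.
  apply: (iffP forallP) => [h a a' b b' ea eb|h [a b]].
    have /forallP/(_ (a', b')) /= := h (a, b).
    by rewrite ea eb !eqxx.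
  apply/forallP=> -[a' b'] /=; apply/implyP=> /eqP ea; apply/implyP=> /eqP eb.
  exact: h ea eb.
have Tdiag : diag_rel X \in T.
  apply/TP; first exact: scheme_diag.
  move=> a a' b b' /eqP; rewrite -(mem_relE _ _ hS) ?inE; last exact: scheme_diag.
  by move=> /eqP /= <-; exact: Efork.
have clT : closed_subset S T.
  apply/closed_subsetP => //; first by apply/set0Pn; exists (diag_rel X).
  move=> a b c /(TP _ (rel_of_in _ _ hS)) ab /(TP _ (rel_of_in _ _ hS)) ac.
  apply/(TP _ (rel_of_in _ _ hS)) => b1 c1 d d' e1 e2.
  (* The path b, a, c is copied to b1, a1, c1, and [d1] is chosen at [a1] as [d] is at [b1]; then
     [E] is chained along d, d1, d'. *)
  have [a1 [e3 e4]] := rel_of_extend a hS (esym e1).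
  have [d1 e5] := rel_of_copy b1 d a1 hS.
  apply: Etr (ac a1 c1 d1 d' _ _); last by rewrite e5.
    by apply/Esym/(ab a1 b1 d1 d); [exact: rel_of_swap | rewrite e5].
  exact: rel_of_swap.
have snT : strongly_normal S T.
  apply/strongly_normalP => // a b a' b' e /(TP _ (rel_of_in _ _ hS)) aa'.
  apply/(TP _ (rel_of_in _ _ hS)) => b1 b1' d d' e1 e2.
  (* Points [a1] and [a1'] copy [a] and [a'] over the pair (b1, b1'), and the triangle a1, b1, d is
     copied to a1', b1', d''. Then [E d d''] holds since (a, a') is in T, and [E d'' d'] since both
     points form a fork at [b1']. *)
  have [a1 [e3 e4]] := rel_of_extend a hS (esym e1).
  have {}e4 := rel_of_swap hS e4.
  have [a1' [e5 e6]] := rel_of_extend a' hS (esym e4).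
  have e7 : rel_of S a1 b1 = rel_of S a1' b1'.
    by rewrite (rel_of_swap hS e3) (rel_of_swap hS e6).
  have [d'' [e8 e9]] := rel_of_extend d hS e7.
  apply: Etr (aa' a1 a1' d d'' e5 (esym e8)) (Efork b1' d'' d' _).
  by rewrite e9.
move=> /bigcapP/(_ T snT)/(TP _ (rel_of_in _ _ hS)) h.
(* The case where r is the diagonal relation. *)
by apply: (h x y x y); rewrite ?rel_of_diag.
Qed.

(** * The thin radical and its product with the thin residue *)

Lemma thin_radicalP (X : finType) (S : {set {set X * X}}) x y :
  association_scheme S ->
  reflect (forall y', rel_of S x y' = rel_of S x y -> y' = y)
          (rel_of S x y \in thin_radical S).
Proof.
move=> hS; rewrite inE rel_of_in //= (valencyE x hS) ?rel_of_in //.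
apply: (iffP cards1P) => [[z ez] y' e|uy].
  have h w : rel_of S x w = rel_of S x y -> w = z.
    by move=> ew; apply/set1P; rewrite -ez inE -ew mem_rel_of.
  by rewrite (h y') // (h y).
exists y; apply/setP=> z; rewrite !inE (mem_relE _ _ hS) ?rel_of_in //.
by apply/eqP/eqP => [/uy|->].
Qed.

Lemma thin_radical_sub (X : finType) (S : {set {set X * X}}) :
  thin_radical S \subset S.
Proof. by apply/subsetP=> r; rewrite inE => /andP[]. Qed.

Lemma thin_radical_sym (X : finType) (S : {set {set X * X}}) x y :
  association_scheme S ->
  rel_of S x y \in thin_radical S -> rel_of S y x \in thin_radical S.
Proof.
move=> hS; rewrite !inE !rel_of_in //= -(rel_of_conv x y hS).
by rewrite (valency_conv hS) // rel_of_in.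
Qed.

Lemma thin_radical_trans (X : finType) (S : {set {set X * X}}) x y z :
  association_scheme S -> rel_of S x y \in thin_radical S ->
  rel_of S y z \in thin_radical S -> rel_of S x z \in thin_radical S.
Proof.
move=> hS /(thin_radicalP _ _ hS) xy /(thin_radicalP _ _ hS) yz.
apply/thin_radicalP => // z' e.
have [y' [e1 e2]] := rel_of_extend y hS (esym e).
by rewrite (xy _ e1) in e2; apply: yz; exact: rel_of_swap.
Qed.

(** The pair (z, z') belongs to the residue, and closedness absorbs this step into the left
    factor. *)
Lemma residue_radical_fork (X : finType) (S : {set {set X * X}}) x z z' y :
  association_scheme S -> rel_of S x z = rel_of S x z' ->
  rel_of S z y \in complex_prod S (thin_residue S) (thin_radical S) ->
  rel_of S z' y \in complex_prod S (thin_residue S) (thin_radical S).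
Proof.
move=> hS e; have RS := thin_residue_sub hS; have OS := thin_radical_sub S.
have clR := thin_residue_closed hS; have /and3P[R0 _ _] := clR.
case/complex_prodP => // w [zw wy]; apply/complex_prodP => //; exists w.
split=> //; exact: (closed_subsetP hS RS R0 clR) (thin_residue_fork hS e) zw.
Qed.

(** Strong normality moves the thin step from [x] to [z] past the residue step from [z] to [w]; it
    then merges with the thin step from [w] to [y]. *)
Lemma residue_radical_thin (X : finType) (S : {set {set X * X}}) x z y :
  association_scheme S -> rel_of S x z \in thin_radical S ->
  rel_of S z y \in complex_prod S (thin_residue S) (thin_radical S) ->
  rel_of S x y \in complex_prod S (thin_residue S) (thin_radical S).
Proof.
move=> hS xz; have RS := thin_residue_sub hS; have OS := thin_radical_sub S.
have clR := thin_residue_closed hS.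
case/complex_prodP => // w [zw wy]; apply/complex_prodP => //.
have [w' ew] := rel_of_copy z x w hS.
exists w'; split.
  exact: (strongly_normalP hS clR (thin_residue_normal hS)) (esym ew) zw.
apply: thin_radical_trans wy => //; apply: thin_radical_sym => //.
by rewrite ew thin_radical_sym.
Qed.

(** * The adjacency algebra and its trivial submodules *)

Local Open Scope ring_scope.

Lemma adjE (F : fieldType) (X : finType) (r : {set X * X}) i j :
  adj F r i j = ((enum_val i, enum_val j) \in r)%:R.
Proof. by rewrite !mxE; case: (_ \in _). Qed.

Lemma adjacency_algebraP (F : fieldType) (X : finType)
    (S : {set {set X * X}}) (v : 'M[F]_#|X|) :
  association_scheme S ->
  (forall x y x' y', rel_of S x y = rel_of S x' y' ->
     v (enum_rank x) (enum_rank y) = v (enum_rank x') (enum_rank y'))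
  <-> v \in adjacency_algebra F S.
Proof.
move=> hS; split=> [cst|]; last first.
  pose s := [seq adj F r | r <- enum S].
  rewrite /adjacency_algebra -/s -[s]/(val (in_tuple s)) => /coord_span -> x y x' y' e.
  rewrite !summxE; apply: eq_bigr => i _; rewrite !mxE; congr (_ * _).
  have /mapP[r] : (in_tuple s)`_i \in s by rewrite mem_nth.
  rewrite mem_enum => rS ->.
  by rewrite !adjE !enum_rankK !(mem_relE _ _ hS) // e.
(* The coefficient of [r] is read off at any pair of [r]; the default 0 concerns only the empty set,
   which is not in S. *)
pose c (r : {set X * X}) := if [pick u in r] is Some u
            then v (enum_rank u.1) (enum_rank u.2)
            else 0.
have cE x y : c (rel_of S x y) = v (enum_rank x) (enum_rank y).
  rewrite /c; case: pickP => [[a b]|/(_ (x, y))]; last by rewrite mem_rel_of.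
  by rewrite (mem_relE _ _ hS) ?rel_of_in // => /eqP; exact: cst.
have -> : v = \sum_(r in S) c r *: adj F r.
  apply/matrixP=> i j; rewrite summxE.
  rewrite -[i]enum_valK -[j]enum_valK; move: (enum_val i) (enum_val j) => x y.
  rewrite (bigD1 (rel_of S x y)) ?rel_of_in //= big1 => [|r /andP[rS nr]].
    by rewrite mxE adjE !enum_rankK mem_rel_of // mulr1 addr0 cE.
  by rewrite mxE adjE !enum_rankK (mem_relE _ _ hS) // eq_sym (negPf nr) mulr0.
apply: memv_suml => r rS; apply/memvZ/memv_span/map_f.
by rewrite mem_enum.
Qed.

Lemma adj_mulmx (F : fieldType) (X : finType) (r : {set X * X})
    (v : 'M[F]_#|X|) x j :
  (adj F r *m v) (enum_rank x) j = \sum_(z | (x, z) \in r) v (enum_rank z) j.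
Proof.
rewrite mxE (reindex enum_rank) /=; last exact: onW_bij (enum_rank_bij _).
rewrite [RHS]big_mkcond; apply: eq_bigr => z _.
by rewrite adjE !enum_rankK; case: ifP; rewrite ?mul1r ?mul0r.
Qed.

(* [c] is the coefficient function of an element of FS spanning (if nonzero) a
   trivial submodule. *)
Definition trivial_coef (F : fieldType) (X : finType) (S : {set {set X * X}})
    (c : X -> X -> F) : Prop :=
  (forall x y x' y', rel_of S x y = rel_of S x' y' -> c x y = c x' y') /\
  (forall r x y, r \in S ->
     \sum_(z | (x, z) \in r) c z y = (valency r)%:R * c x y).

Lemma trivial_coefP (F : fieldType) (X : finType) (S : {set {set X * X}})
    (v : 'M[F]_#|X|) :
  association_scheme S ->
  trivial_coef S (fun x y => v (enum_rank x) (enum_rank y)) <->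
  v \in adjacency_algebra F S /\
  forall r, r \in S -> adj F r *m v = (valency r)%:R *: v.
Proof.
move=> hS; have algP := adjacency_algebraP v hS.
split=> -[/algP hv eig]; split=> // r.
  move=> rS; apply/matrixP=> i j; rewrite -[i]enum_valK -[j]enum_valK.
  by rewrite adj_mulmx eig // [RHS]mxE.
by move=> x y rS; rewrite -adj_mulmx eig // mxE.
Qed.

Lemma trivial_coef_const (F : fieldType) (X : finType) (S : {set {set X * X}}) :
  association_scheme S -> trivial_coef S (fun _ _ : X => 1 : F).
Proof.
move=> hS; split=> // r x y rS.
by rewrite sumr_const mulr1 (valencyE x hS rS) cardsE.
Qed.

(** The all-one matrix [J] always spans a trivial submodule, so uniqueness means that every solution
    is a multiple of [J]. *)
Lemma p_transitiveP (F : fieldType) (X : finType) (S : {set {set X * X}}) :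
  association_scheme S -> (0 < #|X|)%N ->
  p_transitive F S <->
  forall c : X -> X -> F, trivial_coef S c ->
    forall x y x' y', c x y = c x' y'.
Proof.
move=> hS X0; pose J : 'M[F]_#|X| := const_mx 1.
have J0 : J != 0.
  apply/eqP=> /matrixP/(_ (Ordinal X0) (Ordinal X0)); rewrite !mxE => /eqP.
  by rewrite oner_eq0.
have trivJ : trivial_submodule S <[J]>%VS.
  have /(trivial_coefP J hS)[J1 J2] :
      trivial_coef S (fun x y => J (enum_rank x) (enum_rank y)).
    have [_ h] := trivial_coef_const F hS; split=> [*|r x y rS]; rewrite !mxE //.
    by rewrite -(h r x y rS); apply: eq_bigr => z _; rewrite mxE.
  by exists J.
split=> [[V [_ uniqV]] c hc|cst].
  pose v : 'M[F]_#|X| := \matrix_(i, j) c (enum_val i) (enum_val j).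
  have vE x y : v (enum_rank x) (enum_rank y) = c x y by rewrite mxE !enum_rankK.
  have /(trivial_coefP v hS)[v1 v2] :
      trivial_coef S (fun x y => v (enum_rank x) (enum_rank y)).
    case: hc => h1 h2; split=> [x y x' y' /h1|r x y rS]; rewrite !vE //.
    by rewrite -h2 //; apply: eq_bigr => z _; rewrite vE.
  have [k vk] : exists k, v = k *: J.
    (* The zero solution spans no trivial submodule and is treated apart. *)
    have [->|v0] := eqVneq v 0; first by exists 0; rewrite scale0r.
    apply/vlineP; rewrite -(uniqV _ trivJ) (uniqV <[v]>%VS) ?memv_line //.
    by exists v.
  by move=> x y x' y'; rewrite -!vE vk !mxE.
exists <[J]>%VS; split=> // _ [v [v1 v0 v2 ->]].
have /(trivial_coefP v hS)/cst vc := conj v1 v2.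
pose k := v (Ordinal X0) (Ordinal X0).
have vk : v = k *: J.
  apply/matrixP=> i j; rewrite !mxE mulr1 -[i]enum_valK -[j]enum_valK /k.
  by rewrite -[Ordinal X0]enum_valK; exact: vc.
have k0 : k != 0 by apply: contraNneq v0 => k0; rewrite vk k0 scale0r.
apply/eqP; rewrite eqEsubv -!memvE; apply/andP; split; apply/vlineP.
  by exists k^-1; rewrite vk scalerA mulVf ?scale1r.
by exists k.
Qed.

(** * Solving for the coefficient functions *)

(** In the equation for the relation r of (x, y), evaluated at (x, x), all summands equal [c y x].
    Cancelling the valency gives [c y x = c x x], and [c] is constant on the diagonal. *)
Lemma trivial_coef_invertible (F : fieldType) (X : finType)
    (S : {set {set X * X}}) (c : X -> X -> F) :
  association_scheme S ->
  (forall r, r \in S -> (valency r)%:R != 0 :> F) ->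
  trivial_coef S c -> forall x y x' y', c x y = c x' y'.
Proof.
move=> hS val0 [cst eig].
have cdiag x y : c y x = c x x.
  apply: (mulfI (val0 _ (rel_of_in x y hS))).
  rewrite -(eig _ x x) ?rel_of_in //.
  rewrite (eq_bigr (fun=> c y x)) => [|z].
    by rewrite sumr_const (valencyE x hS) ?rel_of_in // cardsE mulr_natl.
  rewrite (mem_relE _ _ hS) ?rel_of_in // => /eqP e.
  by apply: cst; exact: rel_of_swap.
move=> x y x' y'; rewrite !cdiag; by apply: cst; rewrite !rel_of_diag.
Qed.

Lemma trivial_coef_thin (F : fieldType) (X : finType)
    (S : {set {set X * X}}) (c : X -> X -> F) x z y :
  association_scheme S -> trivial_coef S c ->
  rel_of S x z \in thin_radical S -> c z y = c x y.
Proof.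
move=> hS [_ eig] xz; have rS := rel_of_in x z hS.
have := eig _ x y rS; move: (xz); rewrite inE rS /= => /eqP ->.
rewrite mul1r => <-; rewrite (big_pred1 z) // => w.
rewrite (mem_relE _ _ hS) //=; apply/eqP/eqP => [|-> //].
by move: w; apply/thin_radicalP.
Qed.

(** If [z] and [z'] differ, they are all the neighbours of [x] in their relation, so the equation
    reads [c z y + c z' y = 0] in characteristic 2. *)
Lemma trivial_coef_fork (F : fieldType) (X : finType)
    (S : {set {set X * X}}) (c : X -> X -> F) x z z' y :
  association_scheme S -> quasi_thin S -> 2%N \in [pchar F] ->
  trivial_coef S c -> rel_of S x z = rel_of S x z' -> c z y = c z' y.
Proof.
move=> hS hqt ch2 [_ eig] e; have [-> //|nz] := eqVneq z z'.
have rS := rel_of_in x z hS.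
have sub : [set z; z'] \subset [set w | (x, w) \in rel_of S x z].
  by apply/subsetP=> w /set2P[]->; rewrite inE ?mem_rel_of // e mem_rel_of.
have val2 : valency (rel_of S x z) = 2%N.
  apply/eqP; rewrite eqn_leq hqt //= (valencyE x hS rS).
  by rewrite (leq_trans _ (subset_leq_card sub)) // cards2 nz.
have eset : [set w | (x, w) \in rel_of S x z] = [set z; z'].
  apply/esym/eqP; rewrite eqEcard sub /= -(valencyE x hS rS) val2.
  by rewrite cards2 nz.
have := eig _ x y rS; rewrite val2 (pcharf0 ch2) mul0r.
rewrite (eq_bigl (fun w => w \in [set z; z'])) => [|w]; last by rewrite -eset inE.
rewrite big_setU1 ?inE //= big_set1 => /eqP; rewrite addr_eq0 => /eqP ->.
by rewrite oppr_pchar2.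
Qed.

(** The indicator is constant on the r-neighbours of [x], so the sum is the valency times that
    value. For valency 1 this is the value at [x]; for valency 2 both sides vanish. *)
Lemma residue_radical_trivial_coef (F : fieldType) (X : finType)
    (S : {set {set X * X}}) :
  association_scheme S -> quasi_thin S -> 2%N \in [pchar F] ->
  trivial_coef S (fun x y =>
    (rel_of S x y \in complex_prod S (thin_residue S) (thin_radical S))%:R : F).
Proof.
move=> hS hqt ch2; set T := complex_prod _ _ _.
split=> [x y x' y' -> //|r x y rS].
have [z0 er] : exists z0, r = rel_of S x z0.
  have [a [b ->]] := rel_of_ex hS rS.
  by have [z0 e] := rel_of_copy a b x hS; exists z0.
have cstz z : (x, z) \in r ->
    (rel_of S z y \in T)%:R = (rel_of S z0 y \in T)%:R :> F.
  rewrite (mem_relE _ _ hS) // er => /eqP e; congr (nat_of_bool _)%:R.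
  apply/idP/idP; first exact: residue_radical_fork e.
  exact: residue_radical_fork (esym e).
rewrite (eq_bigr _ cstz) sumr_const -cardsE -(valencyE x hS rS).
rewrite -[LHS]mulr_natl.
have [vr1|vr1] := eqVneq (valency r) 1%N.
  congr (_ * (nat_of_bool _)%:R).
  have xz0 : rel_of S x z0 \in thin_radical S by rewrite -er inE rS vr1.
  apply/idP/idP; first exact: residue_radical_thin.
  by apply: residue_radical_thin => //; exact: thin_radical_sym.
have -> : valency r = 2%N.
  have := hqt _ rS; have := valency_gt0 hS rS.
  by case: (valency r) vr1 => [|[|[|]]].
by rewrite (pcharf0 ch2) !mul0r.
Qed.

(* The characterisation of p-transitivity *)
Local Close Scope ring_scope.

Theorem theoremA (F : fieldType) (p : nat) (hp : p \in [pchar F]%R)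
    (X : finType) (hX : 0 < #|X|) (S : {set {set X * X}})
    (hS : association_scheme S) (hqt : quasi_thin S) :
  p_transitive F S <->
    (2 < p \/
     (p = 2 /\ S = complex_prod S (thin_residue S) (thin_radical S))).
Proof.
set T := complex_prod _ _ _.
have RS := thin_residue_sub hS; have OS := thin_radical_sub S.
have p_pr := pcharf_prime hp.
split=> [/(p_transitiveP F hS hX) cst|cond].
  have [p2|] := eqVneq p 2%N; last first.
    by move=> p2; left; rewrite ltn_neqAle eq_sym p2 prime_gt1.
  right; split=> //; rewrite p2 in hp.
  apply/eqP; rewrite eqEsubset complex_prod_sub andbT; apply/subsetP=> t tS.
  have [x [y ->]] := rel_of_ex hS tS.
  (* The indicator of T is constant and equals 1 on the diagonal, so T is all of S. *)
  have := cst _ (residue_radical_trivial_coef hS hqt hp) x x x y.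
  rewrite -/T; have -> : rel_of S x x \in T.
    apply/complex_prodP => //; exists x; split.
      by rewrite closed_diag // thin_residue_closed.
    apply/thin_radicalP => // x' /eqP; rewrite rel_of_diag //.
    by rewrite -(mem_relE _ _ hS) ?inE ?scheme_diag // => /eqP.
  by case: (_ \in T) => // /eqP; rewrite oner_eq0.
apply/(p_transitiveP F hS hX) => c hc; case: cond => [p2|[p2 ST]].
  apply: trivial_coef_invertible hc => // r rS.
  rewrite -(dvdn_pcharf hp) gtnNdvd ?(valency_gt0 hS) //.
  exact: leq_ltn_trans (hqt _ rS) p2.
rewrite p2 in hp.
(* Equality of rows of [c] is an equivalence relation containing all forks, hence all pairs of the
   thin residue. *)
pose E : rel X := fun x y => [forall z, c x z == c y z].
have EP x y : reflect (forall z, c x z = c y z) (E x y).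
  by apply: (iffP forallP) => h z; apply/eqP.
have Eres x y : rel_of S x y \in thin_residue S -> E x y.
  apply: thin_residue_min => //.
  - by move=> a b /EP ab; apply/EP=> z; rewrite ab.
  - by move=> a b d /EP ab /EP bd; apply/EP=> z; rewrite ab.
  - by move=> a b b' e; apply/EP=> z; exact: trivial_coef_fork hc e.
have cdiag x y : c x y = c y y.
  (* A residue step to [z] followed by a thin step to [y] gives [c x y = c z y = c y y]. *)
  have := rel_of_in x y hS; rewrite {2}ST => /complex_prodP[] // z [xz zy].
  by rewrite (EP _ _ (Eres _ _ xz)) (trivial_coef_thin y hS hc zy).
move=> x y x' y'; rewrite !cdiag; by apply: (proj1 hc); rewrite !rel_of_diag.
Qed.
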